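(* Let $X$ be a $T_0$ space. If the sobrification $X^s$ of $X$ is first-countable, then $X$ is an $\omega$-Rudin space.
   Context: For a $T_0$ space $X$, the specialization order is $x\le y$ iff $x\in\overline{\{y\}}$; a subset is saturated if it is an upper set in this order (equivalently, an intersection of open sets). $\mathsf{K}(X)$ is the set of all nonempty compact saturated subsets of $X$. A nonempty set $A\subseteq X$ is irreducible if whenever $A\subseteq F_1\cup F_2$ with $F_1,F_2$ closed, then $A\subseteq F_1$ or $A\subseteq F_2$; $\mathsf{Irr}_c(X)$ is the set of irreducible closed subsets of $X$. The sobrification $X^s$ is the set $\mathsf{Irr}_c(X)$ with the topology whose open sets are $\Diamond U=\{A\in\mathsf{Irr}_c(X): A\cap U\neq\emptyset\}$, $U$ open in $X$. For a family $\mathcal K$ of subsets of $X$, let $M(\mathcal K)$ be the set of closed sets $A\subseteq X$ with $A\cap K\ne\emptyset$ for all $K\in\mathcal K$, and let $m(\mathcal K)$ be the set of minimal (under inclusion) members of $M(\mathcal K)$. A family $\mathcal K\subseteq\mathsf K(X)$ is filtered if it is nonempty and for all $K_1,K_2\in\mathcal K$ there is $K_3\in\mathcal K$ with $K_3\subseteq K_1\cap K_2$. A closed set $A$ is an $\omega$-Rudin set if there is a countable filtered family $\mathcal K\subseteq\mathsf K(X)$ with $A\in m(\mathcal K)$. A $T_0$ space $X$ is an $\omega$-Rudin space if every irreducible closed subset of $X$ is an $\omega$-Rudin set. *)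

(* Defs.v *)
From HB Require Import structures.
From mathcomp Require Import all_boot all_classical.
From mathcomp Require Import topology.

Set Implicit Arguments.
Unset Strict Implicit.
Unset Printing Implicit Defensive.

Local Open Scope classical_set_scope.

Section Notions.
Context {X : topologicalType}.
Implicit Types (x y : X) (A B : set X) (KK : set_system X).

Definition specialization x y := closure [set y] x.

Definition saturated A := forall x y, A x -> specialization x y -> A y.

Definition compact_saturated : set_system X :=
  [set K | [/\ K !=set0, compact K & saturated K]].

Definition irreducible A := A !=set0 /\
  forall F1 F2 : set X, closed F1 -> closed F2 ->
    A `<=` F1 `|` F2 -> A `<=` F1 \/ A `<=` F2.

Definition irr_closed : set_system X := [set A | irreducible A /\ closed A].

Definition meeting_closed KK : set_system X :=
  [set A | closed A /\ forall K, KK K -> A `&` K !=set0].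

Definition minimal_meeting_closed KK : set_system X :=
  [set A | meeting_closed KK A /\
    forall B, meeting_closed KK B -> B `<=` A -> B = A].

(* Downward directedness only; unlike a [Filter], no upward closure. *)
Definition filtered_family KK := KK !=set0 /\
  forall K1 K2, KK K1 -> KK K2 -> exists2 K3, KK K3 & K3 `<=` K1 `&` K2.

Definition omega_rudin_set A := closed A /\
  exists KK : set_system X, [/\ KK `<=` compact_saturated, countable KK,
    filtered_family KK & minimal_meeting_closed KK A].

End Notions.

Definition omega_rudin_space (X : topologicalType) :=
  @kolmogorov_space X /\
  forall A : set X, irr_closed A -> omega_rudin_set A.

Definition first_countable (T : topologicalType) :=
  forall x : T, exists2 B : set_system T, countable B &
    B `<=` nbhs x /\ filter_from B id --> x.

Definition sobrification (X : topologicalType) : Type :=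
  set_type (@irr_closed X).

Section Sobrification.
Context (X : topologicalType).
Local Notation Xs := (sobrification X).

HB.instance Definition _ := Choice.copy Xs (set_type (@irr_closed X)).

Definition diamond (U : set X) : set Xs :=
  [set A : Xs | set_val A `&` U !=set0].

Definition sobrification_open : set_system Xs := diamond @` open.

Lemma sobrification_openT : sobrification_open setT.
Proof.
exists setT; first exact: openT.
rewrite eqEsubset; split=> // -[A /= AI] _.
have [[A0 _] _] := set_mem AI.
by rewrite /diamond /= setIT.
Qed.

Lemma sobrification_openI : setI_closed sobrification_open.
Proof.
move=> _ _ [U oU <-] [V oV <-]; exists (U `&` V); first exact: openI.
rewrite eqEsubset; split=> [A [x [Ax [Ux Vx]]]|A [[x [Ax Ux]] [y [Ay Vy]]]].
  by split; exists x.
have [[_ Airr] _] : irr_closed (set_val A) := set_mem (valP A).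
apply: contrapT => AUV.
have AUV' : set_val A `<=` ~` U `|` ~` V.
  by rewrite -setCI => z Az UVz; apply: AUV; exists z.
have [AU|AV] := Airr _ _ (open_closedC oU) (open_closedC oV) AUV'.
- exact: AU Ux.
- exact: AV Vy.
Qed.

Lemma sobrification_open_bigU (I : Type) (f : I -> set Xs) :
  (forall i, sobrification_open (f i)) -> sobrification_open (\bigcup_i f i).
Proof.
move=> fop; pose U i := s2val (cid2 (fop i)).
exists (\bigcup_i U i).
  by apply: bigcup_open => i _; exact: (s2valP (cid2 (fop i))).
have fE i : f i = diamond (U i) by rewrite (s2valP' (cid2 (fop i))).
rewrite eqEsubset; split=> A.
  by move=> [x [Ax [i _ Ux]]]; exists i => //; rewrite fE; exists x.
by move=> [i _]; rewrite fE => -[x [Ax Ux]]; exists x; split=> //; exists i.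
Qed.

HB.instance Definition _ := isOpenTopological.Build Xs
  sobrification_openT sobrification_openI sobrification_open_bigU.

Lemma sobrification_openE : (open : set_system Xs) = sobrification_open.
Proof. by []. Qed.

End Sobrification.

(* Main.v *)
(* An irreducible closed set A is a point of the sobrification X^s.  Sampling a
   countable base of neighbourhoods of that point yields a sequence x in A that
   converges in X to every point of A.  Such a sequence converges to each of its
   own terms, so the saturations K_n of its tails are compact: the member of an
   open cover that contains one term contains almost all of them.  If a closed
   B meets every K_n, then, being a lower set, it contains x_k for arbitrarily
   large k, so its complement is a neighbourhood of no point of A; thus A is
   contained in B, and A is minimal. *)
Require Import Defs.
From mathcomp Require Import all_boot all_classical.
From mathcomp Require Import topology.

Set Implicit Arguments.
Unset Strict Implicit.
Unset Printing Implicit Defensive.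

Local Open Scope classical_set_scope.

Section Specialization.
Context {X : topologicalType}.
Implicit Types (x y z : X) (A B U : set X).

Lemma specialization_refl x : specialization x x.
Proof. exact: subset_closure. Qed.

Lemma closed_specialization B x y :
  closed B -> specialization x y -> B y -> B x.
Proof. by move=> cB xy By; apply/cB/(closureS _ xy) => _ ->. Qed.

Lemma nbhs_specialization U x y : nbhs x U -> specialization x y -> U y.
Proof. by move=> xU /(_ _ xU)[_ [->]]. Qed.

Lemma specialization_trans x y z :
  specialization x y -> specialization y z -> specialization x z.
Proof.
by move=> xy; apply: closed_specialization xy; exact: closed_closure.
Qed.

Lemma irr_closed_closure1 x : irr_closed (closure [set x]).
Proof.
split; last exact: closed_closure.
split; first by exists x; exact: specialization_refl.
move=> F G cF cG /(_ x (@specialization_refl x))[Fx|Gx]; [left|right].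
  by move=> y yx; exact: closed_specialization Fx.
by move=> y yx; exact: closed_specialization Gx.
Qed.

End Specialization.

Definition tail_saturation {X : topologicalType} (x : nat -> X) (n : nat) :=
  [set y | exists2 k, n <= k & specialization (x k) y].

Section TailSaturation.
Context {X : topologicalType} (x : nat -> X).

Lemma tail_saturation_refl n : tail_saturation x n (x n).
Proof. by exists n => //; exact: specialization_refl. Qed.

Lemma tail_saturation_le m n :
  m <= n -> tail_saturation x n `<=` tail_saturation x m.
Proof. by move=> mn y [k nk ky]; exists k => //; exact: leq_trans nk. Qed.

Lemma tail_saturation_saturated n : saturated (tail_saturation x n).
Proof.
by move=> y z [k nk ky] yz; exists k => //; exact: specialization_trans yz.
Qed.

Lemma filtered_tail_saturation : filtered_family (range (tail_saturation x)).
Proof.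
split; first by exists (tail_saturation x 0), 0.
move=> _ _ [m _ <-] [n _ <-]; exists (tail_saturation x (maxn m n)).
  by exists (maxn m n).
by rewrite subsetI; split; apply: tail_saturation_le;
  rewrite ?leq_maxl ?leq_maxr.
Qed.

Hypothesis x_cvg : forall k, x @ \oo --> x k.

Lemma compact_tail_saturation n : compact (tail_saturation x n).
Proof.
move=> F FF FK; apply: contrapT => noclust.
(* Failure of clustering at [x k] gives a filter set and a neighbourhood of [x k] that are disjoint;
   the default pair for [k < n] only serves to make the choice total. *)
have sep k : exists GV : set X * set X, n <= k ->
    [/\ F GV.1, nbhs (x k) GV.2 & GV.1 `&` GV.2 = set0].
  have [nk|] := boolP (n <= k); last by exists (set0, set0).
  have : ~ cluster F (x k).
    move=> Fk; apply: noclust; exists (x k); split=> //.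
    exact: (tail_saturation_le nk (tail_saturation_refl k)).
  move=> /existsNP[G /existsNP[V /not_implyP[FG /not_implyP[kV GV]]]].
  by exists (G, V) => _; split=> //; apply/eqP/negPn/negP => /set0P.
have {sep} [GV GVP] := choice sep.
have [Fn xnV GVn0] := GVP n (leqnn n).
(* Convergence to [x n] is applied to the interior, so that [(GV n).2] is a neighbourhood of almost
   all terms and hence contains every point above them. *)
have [m _ xV] : \forall k \near \oo, nbhs (x k) (GV n).2.
  exact: (x_cvg (nbhs_interior xnV)).
have Fm : F [set y | forall k : 'I_m, n <= k -> (GV k).1 y].
  apply: filter_forall => k; have [nk|nk] := boolP (n <= k).
    by have [Fk _ _] := GVP k nk; apply: filterS Fk.
  by apply: filterS filterT => y _.
(* Since [y] lies above [x k], it is in every neighbourhood of [x k]: in [(GV n).2] if [m <= k], in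
   [(GV k).2] if [k < m]. Both are disjoint from a filter set containing [y]. *)
have [y [[[k nk ky] yG] yGn]] := filter_ex (filterI (filterI FK Fm) Fn).
have [mk|km] := leqP m k.
  rewrite -[False]/(set0 y) -GVn0; split=> //.
  exact: nbhs_specialization (xV k mk) ky.
have [_ kV GVk0] := GVP k nk.
rewrite -[False]/(set0 y) -GVk0; split; first exact: (yG (Ordinal km)).
exact: nbhs_specialization kV ky.
Qed.

Lemma compact_saturated_tail n : compact_saturated (tail_saturation x n).
Proof.
split; first by exists (x n); exact: tail_saturation_refl.
  exact: compact_tail_saturation.
exact: tail_saturation_saturated.
Qed.

End TailSaturation.

Lemma minimal_meeting_tail_saturation (X : topologicalType) (A : set X)
    (x : nat -> X) : closed A -> (forall n, A (x n)) ->
  (forall a, A a -> x @ \oo --> a) ->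
  minimal_meeting_closed (range (tail_saturation x)) A.
Proof.
move=> cA Ax xA; split.
  split=> // _ [n _ <-]; exists (x n); split=> //.
  exact: tail_saturation_refl.
move=> B [cB BK] BA; apply/seteqP; split=> // a Aa.
apply: contrapT => nBa.
have [m _ mB] : \forall k \near \oo, (~` B) (x k).
  by apply: (xA a Aa); apply: open_nbhs_nbhs; split=> //; exact: closed_openC.
have [|y [By [k mk ky]]] := BK (tail_saturation x m); first by exists m.
by apply: (mB k mk); exact: closed_specialization By.
Qed.

Section Sobrification.
Context (X : topologicalType).
Local Notation Xs := (sobrification X).

Definition point_closure (x : X) : Xs :=
  SigSub (mem_set (irr_closed_closure1 x)).

Lemma diamond_point_closure (U : set X) (x : X) :
  open U -> diamond U (point_closure x) <-> U x.
Proof.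
move=> oU; split=> [[y [yx Uy]]|Ux].
  by apply: nbhs_specialization yx; exact: open_nbhs_nbhs.
by exists x; split=> //; exact: specialization_refl.
Qed.

Lemma nbhs_diamond (A : Xs) (U : set X) :
  open U -> set_val A `&` U !=set0 -> nbhs A (diamond U).
Proof.
by move=> oU AU; apply: open_nbhs_nbhs; split=> //; exists U.
Qed.

(** Supplies the sample points: a basic neighbourhood [diamond U] of [A] contains the closure of any
    point of [A] in [U]. *)
Lemma nbhs_point_closure (A : Xs) (W : set Xs) :
  nbhs A W -> exists2 a, set_val A a & W (point_closure a).
Proof.
rewrite nbhsE => -[_ [[U oU <-] [a [Aa Ua]]] UW].
by exists a => //; apply: UW; apply/diamond_point_closure.
Qed.

Lemma first_countable_seq_cvg (A : Xs) : first_countable Xs ->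
  exists x : nat -> X, (forall n, set_val A (x n)) /\
    forall a, set_val A a -> x @ \oo --> a.
Proof.
move=> /(_ A)[B cB [BA AB]].
(* An empty [B] would generate no neighbourhood at all, not even the whole space. Otherwise [g]
   covers [B], and the guard [B (g i)] below discards values outside [B]. *)
have [B0|[g]] := pfcard_geP cB.
  by have [W] := AB _ filterT; rewrite B0.
have bn n : \forall C \near A, forall i : 'I_n.+1, B (g i) -> g i C.
  refine (@filter_forall _ 'I_n.+1 (fun i C => B (g i) -> g i C) (nbhs A)
    _ _) => i.
  have [/BA Bgi|nB] := pselect (B (g i)).
    by apply: filterS Bgi.
  by apply: filterS filterT => C _.
(* The closure of [x n] lies in all base sets among [g 0], ..., [g n]; including index [n] makes
   [i <= n] suffice at the end. *)
have /choice[x xP] n : exists a, set_val A a /\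
    forall i : 'I_n.+1, B (g i) -> g i (point_closure a).
  by have [a] := nbhs_point_closure (bn n); exists a.
exists x; split=> [n|a Aa V]; first by have [] := xP n.
rewrite nbhsE => -[U [oU Ua] UV].
have [W BW WU] : filter_from B id (diamond U).
  by apply: AB; apply: nbhs_diamond => //; exists a.
have [i _ giW] : (g @` setT) W by exact: (@surj _ _ _ _ g).
exists i => // n /= ni; apply: UV; apply/diamond_point_closure => //.
apply: WU; rewrite -giW; have [_ /(_ (Ordinal (ni : i < n.+1)))] := xP n.
by apply; rewrite /= giW.
Qed.

End Sobrification.

Theorem theorem6p7 (X : topologicalType) (hT0 : @kolmogorov_space X)
  (hfc : first_countable (sobrification X)) : omega_rudin_space X.
Proof.
split=> // A irrA; have [_ cA] := irrA; split=> //.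
have [x [Ax xA]] :=
  first_countable_seq_cvg (SigSub (mem_set irrA) : sobrification X) hfc.
exists (range (tail_saturation x)); split.
(* Every term is a point of [A], so the sequence converges to each of its terms, as compactness
   requires. *)
- by move=> _ [n _ <-]; apply: compact_saturated_tail => k; exact/xA/Ax.
- exact: card_image_le.
- exact: filtered_tail_saturation.
- exact: minimal_meeting_tail_saturation.
Qed.
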